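(* Let $T\ge 1$, $\mathcal T=\{1,\dots,T\}$, $\rho>0$, let $\varepsilon\in[0,1]$ be a risk tolerance level, and let the loss $\mathcal L$ take values in $[0,1]$. Let $\mathcal D_{1:T}$ be a sequence of parameterized families of storage dispatch decisions $D_t^{\gamma}$, $\gamma\in\mathbb R$, $t\in\mathcal T$. Let $\gamma_1\in\mathbb R$ and let the control variable be updated by $$\gamma_{t+1}=\gamma_t+\rho\,(\varepsilon-\ell_t),\qquad t\in\mathcal T,\qquad \ell_t:=\mathcal L\big(D_t^{\gamma_t}(x_t),y_t\big),$$ where $\ell_t$ is the realized loss at time $t$ under the dispatch decision $D_t^{\gamma_t}$ with state-value pair $(x_t,y_t)$. Suppose that $\mathcal D_{1:T}$ is eventually safe for some horizon $K\in\mathcal T$, with threshold $\gamma^{\text{safe}}\in\mathbb R$ and tolerance $\varepsilon^{\text{safe}}\le\varepsilon$. Then, for any realization of the electricity prices, the cumulative risk $\hat R_t(D_{1:t},\gamma_{1:t})=\frac1t\sum_{s=1}^{t}\ell_s$ satisfies $$\hat R_t(D_{1:t},\gamma_{1:t})\le \varepsilon+O(1/t)\qquad\text{for all } t\in\{K,\dots,T\},$$ where the constant implied by $O(1/t)$ may depend on $\rho,\varepsilon,\gamma_1,\gamma^{\text{safe}},K$ but not on $t$, $T$ or the realization of the prices.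
   Context: Setting. An energy storage unit takes a dispatch decision $(p_t,b_t)$ (discharge power, charge power) at each time $t\in\mathcal T=\{1,\dots,T\}$ in response to the electricity price $\lambda_t$. The state of charge after step $t$ is $e_t\in[0,E]$. The state at time $t$ is $x_t=(e_{t-1},\lambda_t,\hat Q_t(\cdot|\lambda_t))$, where $\hat Q_t(e|\lambda_t)$ is a predicted opportunity value function of the state of charge $e\in[0,E]$. The value $y_t$ is $\bar Q_t(e_t|\lambda_{t+1})$ (or its derivative in $e_t$), where $\bar Q_{t}(e_{t}|\lambda_{t+1})$ is the corrected value, i.e. the maximum of $\lambda_{t+1}(p-b)-Cp+\hat Q_{t+1}(e|\lambda_{t+1})$ over the feasible discharge power, charge power and next state of charge $(p,b,e)$ starting from $e_t$, with $C$ the marginal discharge cost. The theorem uses no further structure of $x_t,y_t$. Parameterized decisions and loss. For each $t$ and each $\gamma\in\mathbb R$, $D_t^{\gamma}$ maps the state $x_t$ to a dispatch decision; $\gamma$ (the conformal control variable) controls the level of conservativeness. The quality of a decision is measured by a loss function $\mathcal L(D_t^{\gamma}(x_t),y_t)\in[0,1]$. Cumulative risk. $\hat R_t(D_{1:t},\gamma_{1:t}):=\frac1t\sum_{s=1}^{t}\mathcal L(D_s^{\gamma_s}(x_s),y_s)$, with $\hat R_0=0$. Eventually safe. $\mathcal D_{1:T}$ is eventually safe if there exist $\varepsilon^{\text{safe}}\in[0,1]$ (tolerance), $\gamma^{\text{safe}}\in\mathbb R$ (threshold) and a horizon $K>0$ such that for every window $[t,t+K-1]\subseteq[1,T]$ and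 every sequence of state-value pairs $\{(x_k,y_k)\}_{k=t}^{t+K-1}$: if $\gamma_k\le\gamma^{\text{safe}}$ for all $k\in[t,t+K-1]$, then $\frac1K\sum_{k=t}^{t+K-1}\mathcal L(D_k^{\gamma_k}(x_k),y_k)\le\varepsilon^{\text{safe}}$. *)

(* Defs.v *)
From HB Require Import structures.
From mathcomp Require Import all_boot all_order all_algebra.
From mathcomp Require Import reals.

Set Implicit Arguments.
Unset Strict Implicit.
Unset Printing Implicit Defensive.

Import Order.TTheory GRing.Theory Num.Theory.
Local Open Scope ring_scope.

(* X, Y and A are the types of states, of values and of dispatch decisions;   *)
(* D t g is the decision rule D_t^g. Times 1, ..., T are natural numbers, and *)
(* the values of D, gamma, x and y at other times play no role.               *)

Definition realized_loss (R : realType) (X Y A : Type) (loss : A -> Y -> R)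
    (D : nat -> R -> X -> A) (gamma : nat -> R) (x : nat -> X) (y : nat -> Y)
    (t : nat) : R :=
  loss (D t (gamma t) (x t)) (y t).

(* At t = 0 this is 0, as both the inverse of 0 and the empty sum are 0.      *)
Definition cumulative_risk (R : realType) (X Y A : Type) (loss : A -> Y -> R)
    (D : nat -> R -> X -> A) (gamma : nat -> R) (x : nat -> X) (y : nat -> Y)
    (t : nat) : R :=
  t%:R^-1 * \sum_(1 <= s < t.+1) realized_loss loss D gamma x y s.

(* Eventual safety with explicit tolerance, threshold and horizon. It is a    *)
(* property of the families D_1, ..., D_T alone: the control values gamma_k   *)
(* of a window are arbitrary, not the iterates of any update rule.            *)
Definition eventually_safe_with (R : realType) (X Y A : Type)
    (loss : A -> Y -> R) (T : nat) (D : nat -> R -> X -> A)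
    (eps_safe gamma_safe : R) (K : nat) : Prop :=
  [/\ 0 <= eps_safe <= 1,
      (0 < K)%N &
      forall (t : nat) (gamma : nat -> R) (x : nat -> X) (y : nat -> Y),
        (1 <= t)%N -> (t + K - 1 <= T)%N ->
        (forall k : nat, (t <= k <= t + K - 1)%N -> gamma k <= gamma_safe) ->
        K%:R^-1 * \sum_(t <= k < t + K) realized_loss loss D gamma x y k
          <= eps_safe].

Definition control_update (R : realType) (X Y A : Type) (loss : A -> Y -> R)
    (T : nat) (D : nat -> R -> X -> A) (rho eps : R)
    (gamma : nat -> R) (x : nat -> X) (y : nat -> Y) : Prop :=
  forall t : nat, (1 <= t <= T)%N ->
    gamma t.+1 = gamma t + rho * (eps - realized_loss loss D gamma x y t).

(* Main.v *)
(* Summing the update rule gives                                              *)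
(*   sum_(s <= t) l_s = t eps + (gamma_1 - gamma_(t+1)) / rho,                *)
(* so a lower bound on gamma that is uniform in t suffices. One step decreases*)
(* gamma by at most rho. If gamma stays below gamma_safe on the K steps before*)
(* t, safety gives gamma_t >= gamma_(t-K); otherwise gamma exceeded gamma_safe*)
(* at most K steps before t, so gamma_t >= gamma_safe - K rho. By strong      *)
(* induction gamma_t >= min(gamma_1, gamma_safe) - K rho.                     *)
Require Import Defs.
From HB Require Import structures.
From mathcomp Require Import all_boot all_order all_algebra.
From mathcomp Require Import reals ring lra zify.

Set Implicit Arguments.
Unset Strict Implicit.
Unset Printing Implicit Defensive.

Import Order.TTheory GRing.Theory Num.Theory.
Local Open Scope ring_scope.

(** By [control_sum], excess cumulative loss is paid for exactly by a fall of [gamma], so the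
    theorem reduces to the floor of [control_lower_bound], which is uniform in time; dividing by [t]
    turns this bounded excess into the [O(1/t)] term. *)

Section ControlSequence.

Variables (R : realType) (rho eps : R) (T : nat) (gamma loss : nat -> R).

Hypothesis update : forall t, (1 <= t <= T)%N ->
  gamma t.+1 = gamma t + rho * (eps - loss t).

Lemma control_sum (a n : nat) : (0 < a)%N -> (a + n <= T.+1)%N ->
  gamma (a + n)%N
    = gamma a + rho * (n%:R * eps - \sum_(a <= k < a + n) loss k).
Proof.
move=> a_gt0; elim: n => [|n IHn] leT.
  by rewrite addn0 big_geq // mul0r subrr mulr0 addr0.
rewrite addnS update; last by lia.
rewrite IHn; last by lia.
rewrite big_nat_recr ?leq_addr //= -natr1; ring.
Qed.

Hypothesis rho_gt0 : 0 < rho.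
Hypothesis eps_ge0 : 0 <= eps.
Hypothesis loss_le1 : forall t, loss t <= 1.

(** Each increment [rho * (eps - loss t)] is at least [- rho], since [eps] is nonnegative and losses
    are at most 1. *)
Lemma control_decrease (a n : nat) : (0 < a)%N -> (a + n <= T.+1)%N ->
  gamma a - rho * n%:R <= gamma (a + n)%N.
Proof.
move=> a_gt0 leT; rewrite control_sum // lerD2l -mulrN ler_pM2l //.
have : \sum_(a <= k < a + n) loss k <= n%:R.
  apply: le_trans (ler_sum _ (fun k _ => loss_le1 k)) _.
  by rewrite sumr_const_nat addKn.
have : 0 <= n%:R * eps by rewrite mulr_ge0.
lra.
Qed.

Variables (K : nat) (gamma_safe : R).

Hypothesis K_gt0 : (0 < K)%N.
Hypothesis safe_window : forall t, (0 < t)%N -> (t + K <= T.+1)%N ->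
  (forall k, (t <= k < t + K)%N -> gamma k <= gamma_safe) ->
  \sum_(t <= k < t + K) loss k <= K%:R * eps.

Lemma control_lower_bound (t : nat) : (0 < t <= T.+1)%N ->
  Num.min (gamma 1%N) gamma_safe - rho * K%:R <= gamma t.
Proof.
have dec a m : (0 < a)%N -> (a <= m <= a + K)%N -> (m <= T.+1)%N ->
    gamma a - rho * K%:R <= gamma m.
  move=> a_gt0 /andP[am maK] mT.
  have := @control_decrease a (m - a) a_gt0; rewrite subnKC // => /(_ mT).
  apply: le_trans; rewrite lerD2l lerN2 ler_pM2l // ler_nat; lia.
have min1 : Num.min (gamma 1%N) gamma_safe <= gamma 1%N.
  by rewrite ge_min lexx.
have min2 : Num.min (gamma 1%N) gamma_safe <= gamma_safe.
  by rewrite ge_min lexx orbT.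
elim/ltn_ind: t => t IHt /andP[t_gt0 tT].
(* Up to time [K] no full window precedes [t], so the drop is measured from [gamma 1]. *)
have [tK|Kt] := leqP t K.
  apply: le_trans (dec 1%N t _ _ _) => //; last by lia.
  by rewrite lerD2r.
have [a a_gt0 ta] : exists2 a, (0 < a)%N & t = (a + K)%N.
  by exists (t - K)%N; lia.
have [/allP small|/allPn[k]] :=
  boolP (all (fun k => gamma k <= gamma_safe) (index_iota a (a + K))).
  (* Over a safe window the losses average at most [eps], so [gamma] does not fall between [a] and
     [a + K] and the floor at [a] carries over with no further loss. *)
  apply: le_trans (IHt a _ _) _; [by lia | by lia |].
  rewrite ta control_sum // -?ta // lerDl mulr_ge0 ?(ltW rho_gt0) // subr_ge0.
  rewrite ta; apply: safe_window => // [|k kaK]; first by rewrite -ta.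
  by apply: small; rewrite mem_index_iota.
rewrite mem_index_iota -ltNge => kaK safe_lt.
(* The drop restarts from [gamma_safe] at time [k], without the induction hypothesis, so drops never
   accumulate. *)
apply: le_trans (dec k t _ _ _); [|lia|lia|lia].
by rewrite lerD2r (le_trans min2) ?ltW.
Qed.

End ControlSequence.

Theorem theorem1 (R : realType) (rho eps gamma1 gamma_safe : R) (K : nat)
    (rho_gt0 : 0 < rho) (eps01 : 0 <= eps <= 1) :
  exists2 c : R, 0 <= c &
    forall (T : nat) (X Y A : Type) (loss : A -> Y -> R)
      (D : nat -> R -> X -> A) (eps_safe : R)
      (x : nat -> X) (y : nat -> Y) (gamma : nat -> R),
      (1 <= T)%N ->
      (1 <= K <= T)%N ->
      (forall (a : A) (v : Y), 0 <= loss a v <= 1) ->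
      eventually_safe_with loss T D eps_safe gamma_safe K ->
      eps_safe <= eps ->
      gamma 1%N = gamma1 ->
      control_update loss T D rho eps gamma x y ->
      forall t : nat, (K <= t <= T)%N ->
        cumulative_risk loss D gamma x y t <= eps + c / t%:R.
Proof.
(* This is [gamma1] minus the floor, divided by [rho]; it is fixed before [T] and the
   realization. *)
pose c := (gamma1 - Num.min gamma1 gamma_safe) / rho + K%:R.
exists c.
  by rewrite addr_ge0 // divr_ge0 ?(ltW rho_gt0) // subr_ge0 ge_min lexx.
move=> T X Y A loss D eps_safe x y gamma _ _ loss01 [_ K_gt0 safe] safe_eps.
move=> gamma1E upd t /andP[Kt tT].
have t_gt0 : (0 < t)%N by lia.
have eps_ge0 : 0 <= eps by case/andP: eps01.
pose l := realized_loss loss D gamma x y.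
have l_le1 s : l s <= 1 by case/andP: (loss01 (D s (gamma s) (x s)) (y s)).
have window a : (0 < a)%N -> (a + K <= T.+1)%N ->
    (forall k, (a <= k < a + K)%N -> gamma k <= gamma_safe) ->
    \sum_(a <= k < a + K) l k <= K%:R * eps.
  move=> a_gt0 aT small; rewrite -ler_pdivrMl ?ltr0n //.
  apply: le_trans safe_eps; apply: safe => [//||k kaK]; first by lia.
  by apply: small; lia.
(* The losses up to [t] determine [gamma t.+1], so the floor is needed up to time [T.+1]. *)
have := control_lower_bound upd rho_gt0 eps_ge0 l_le1 K_gt0 window
  (t := t.+1) tT.
have := control_sum upd (a := 1%N) (n := t) isT tT.
rewrite add1n gamma1E -/l => -> lower.
have t_pos : 0 < t%:R :> R by rewrite ltr0n.
rewrite /cumulative_risk -/l ler_pdivrMl //.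
have -> : t%:R * (eps + c / t%:R) = t%:R * eps + c by field; rewrite gt_eqF.
rewrite -(ler_pM2l rho_gt0).
have -> : rho * (t%:R * eps + c)
    = rho * (t%:R * eps) + (gamma1 - Num.min gamma1 gamma_safe) + rho * K%:R.
  by rewrite /c; field; rewrite gt_eqF.
lra.
Qed.
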